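(* Let $(V,E)$ be a connected interval graph. If $(V,E)$ does not contain a buried subgraph, then the graph $(W,Q)$ has exactly two connected components, where $W=\{(a,b)\in V\times V\mid\neg\,a\,E\,b\}$ and $(a,b)\,Q\,(c,d)$ iff $a\,E\,c$ and $b\,E\,d$.
   Context: A graph $(V,E)$ has $E$ symmetric; connected means any two vertices are joined by a path. An interval graph is a reflexive graph for which there exist a linear order $L$ and an assignment of a nonempty interval $F(v)\subseteq L$ to each vertex with $v\,E\,u\iff F(v)\cap F(u)\ne\emptyset$. For $B\subseteq V$, $K(B)=\{x\in V\mid\forall b\in B\,(x\,E\,b)\}$, $R(B)=V\setminus(B\cup K(B))$; $B$ is a buried subgraph if (i) some $a,b\in B$ satisfy $\neg\,a\,E\,b$; (ii) $K(B)\cap B=\emptyset$ and $R(B)\ne\emptyset$; (iii) $\neg\,b\,E\,r$ for all $b\in B$, $r\in R(B)$.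
   Formalization: The graph is additionally assumed not to be complete (some a, b satisfy ¬ a E b); for a complete graph, such as a single vertex, W is empty and (W,Q) has no components, so the claim fails. *)

(* Defs.v *)
From mathcomp Require Import all_boot all_order.
From mathcomp Require Import boolp classical_sets cardinality.
From Stdlib Require Import Relation_Definitions Relation_Operators.

Set Implicit Arguments.
Unset Strict Implicit.
Unset Printing Implicit Defensive.

Local Open Scope order_scope.
Local Open Scope classical_set_scope.

(* A graph is a symmetric relation on an arbitrary, possibly infinite, type of
   vertices; loops are allowed. *)

Definition joined (V : Type) (E : relation V) : relation V := clos_refl_trans V E.

Definition connected_graph (V : Type) (E : relation V) : Prop :=
  forall x y, joined E x y.

Definition component (V : Type) (E : relation V) (x : V) : set V :=
  [set y | joined E x y].

Definition components (V : Type) (E : relation V) : set (set V) :=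
  range (component E).

(* Intervals are the order-convex sets: they need not have endpoints in L. *)
Definition order_convex (d : Order.disp_t) (L : orderType d) (I : set L) : Prop :=
  forall x y, I x -> I y -> forall z, x <= z <= y -> I z.

Definition interval_graph (V : Type) (E : relation V) : Prop :=
  [/\ reflexive V E, symmetric V E &
      exists (d : Order.disp_t) (L : orderType d) (F : V -> set L),
        (forall v, F v !=set0 /\ order_convex (F v)) /\
        (forall u v, E u v <-> F u `&` F v !=set0)].

Section Buried.
Variables (V : Type) (E : relation V).

Definition K (B : set V) : set V := [set x | forall b, B b -> E x b].

Definition R (B : set V) : set V := ~` (B `|` K B).

Definition buried (B : set V) : Prop :=
  [/\ exists a b, [/\ B a, B b & ~ E a b],
      K B `&` B = set0 /\ R B !=set0 &
      forall b r, B b -> R B r -> ~ E b r].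

End Buried.

(* W has no element, and hence Q has no component, when E is complete. *)
Definition W (V : Type) (E : relation V) : Type := {p : V * V | ~ E p.1 p.2}.

Definition Q (V : Type) (E : relation V) : relation (W E) :=
  fun p q => E (sval p).1 (sval q).1 /\ E (sval p).2 (sval q).2.

Arguments Q {V} E p q.

(* Main.v *)
Require Import Defs.
From mathcomp Require Import all_boot all_order.
From mathcomp Require Import boolp classical_sets cardinality.
From Stdlib Require Import Relation_Definitions Relation_Operators.

Set Implicit Arguments.
Unset Strict Implicit.
Unset Printing Implicit Defensive.

Import Order.TTheory.

Local Open Scope order_scope.
Local Open Scope classical_set_scope.

(** The intervals order every non-adjacent pair, and [Q] preserves this
    orientation, so there are at least two components, exchanged by swapping
    the coordinates.  In the terminology of Gallai, the components are the
    implication classes of the complement of [E]; by his triangle lemma, a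
    vertex that is non-adjacent to both ends of one pair of a class, without
    forming with either end a pair of the class, behaves in this way towards
    all pairs of the class.  Hence the vertices met by a class form a module,
    which is buried unless it is completely joined to its complement.  If no
    subgraph is buried, two upward classes meet the same vertices, since
    otherwise they would span an induced 4-cycle, and the triangle lemma then
    forces them to coincide. *)

(** * Components of a symmetric relation *)

Lemma joined_sym (V : Type) (E : relation V) :
  symmetric V E -> symmetric V (joined E).
Proof.
move=> symE x y; elim=> {x y} [x y /symE xy|x|x y z _ yx _ zy].
- exact: rt_step.
- exact: rt_refl.
- exact: rt_trans zy yx.
Qed.

Lemma joined_map (V V' : Type) (E : relation V) (E' : relation V')
    (f : V -> V') :
  (forall x y, E x y -> E' (f x) (f y)) ->
  forall x y, joined E x y -> joined E' (f x) (f y).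
Proof.
move=> homf x y; elim=> {x y} [x y /homf xy|x|x y z _ xy _ yz].
- exact: rt_step.
- exact: rt_refl.
- exact: rt_trans xy yz.
Qed.

Lemma component_eq (V : Type) (E : relation V) (x y : V) :
  symmetric V E -> component E x = component E y <-> joined E x y.
Proof.
move=> /joined_sym symJ; split=> [eq_xy|xy].
  suff : component E y y by rewrite -eq_xy.
  by rewrite /component /=; apply: rt_refl.
have sub u v : joined E u v -> component E v `<=` component E u.
  by move=> uv z; apply: rt_trans uv.
by apply/seteqP; split; apply: sub => //; apply: symJ.
Qed.

Lemma card_set2 (T : Type) (x y : T) : x <> y -> ([set x; y] #= `I_2)%card.
Proof.
move=> nxy; apply/card_set_bijP.
exists (fun z => if pselect (z = x) then 0%N else 1%N); split.
- by move=> z _ /=; case: pselect.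
- move=> z t; rewrite !inE => -[->|->] [->|->] //;
    by do 2?case: pselect => // ?; congruence.
- move=> [|[|//]] _; [exists x|exists y]; try by [left|right].
    by case: pselect.
  by case: pselect => // eyx; case: nxy.
Qed.

(** * Orientation of the non-adjacent pairs *)

Definition interval_order (V : Type) (E prec : relation V) : Prop :=
  [/\ forall a b, prec a b -> ~ E a b,
      forall a b, ~ E a b -> prec a b \/ prec b a &
      forall a b c d, prec a b -> prec c d -> E a d -> E b c -> False].

(** Disjoint intervals lie entirely on one side of each other. Against the third clause, a point [x]
    common to [a] and [d] and a point [y] common to [b] and [c] would satisfy [x < y < x]; this
    clause is what makes [Q] preserve the orientation. *)
Lemma interval_graph_order (V : Type) (E : relation V) :
  interval_graph E -> exists prec, interval_order E prec.
Proof.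
case=> _ _ [disp [L [F [FP EP]]]].
exists (fun u v => forall x y, F u x -> F v y -> x < y); split.
- by move=> a b ab /EP[x [ax bx]]; have := ab _ _ ax bx; rewrite ltxx.
- move=> a b nab.
  have disj x : F a x -> F b x -> False.
    by move=> ax bx; apply: nab; apply/EP; exists x.
  have [[x0 ax0] cvxa] := FP a; have [[y0 by0] cvxb] := FP b.
  (* Two pairs of points comparing in opposite directions make the intervals meet: by convexity [t]
     lies in [F a] if [x <= t], and otherwise [x] lies in [F b]. *)
  have side x y z t : F a x -> F b y -> F a z -> F b t ->
      x < y -> t < z -> False.
    move=> ax fy az bt xy tz.
    have [xt|tx] := leP x t.
      by apply: (disj t) => //; apply: (cvxa x z) => //; rewrite xt ltW.
    by apply: (disj x) => //; apply: (cvxb t y) => //; rewrite !ltW.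
  case: (ltgtP x0 y0) => [lt0|gt0|eq0].
  + left=> x y ax fy; case: (ltgtP x y) => // [gt|exy].
      by case: (side x0 y0 x y).
    by case: (disj x) => //; rewrite exy.
  + right=> y x fy ax; case: (ltgtP y x) => // [gt|exy].
      by case: (side x y x0 y0).
    by case: (disj x) => //; rewrite -exy.
  + by case: (disj x0) => //; rewrite eq0.
- move=> a b c d ab cd /EP[x [ax dx]] /EP[y [fy cy]].
  by have := lt_trans (ab _ _ ax fy) (cd _ _ cy dx); rewrite ltxx.
Qed.

(** * Implication classes of the complement *)

Section Classes.
Variables (V : Type) (E : relation V).
Hypotheses (reflE : reflexive V E) (symE : symmetric V E).

Lemma Q_sym : symmetric (W E) (Q E).
Proof. by move=> p q [/symE ? /symE ?]. Qed.

Definition pair (u v : V) (nuv : ~ E u v) : W E :=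
  exist (fun p : V * V => ~ E p.1 p.2) (u, v) nuv.

Lemma swap_proof (p : W E) : ~ E (sval p).2 (sval p).1.
Proof. by move=> /symE; apply: (svalP p). Qed.

Definition swap (p : W E) : W E := pair (@swap_proof p).

Lemma swapK : involutive swap.
Proof. by move=> [[a b] nab]; apply: eq_exist. Qed.

Lemma joined_swap (p q : W E) :
  joined (Q E) p q -> joined (Q E) (swap p) (swap q).
Proof. by apply: joined_map => {}p {}q []. Qed.

(** The class of [p] as a relation on vertices; the existential hides the proof of non-adjacency
    carried by elements of [W E]. *)
Definition cl (p : W E) (u v : V) : Prop :=
  exists nuv : ~ E u v, joined (Q E) p (pair nuv).

Definition scl (p : W E) (u v : V) : Prop := cl p u v \/ cl p v u.

Definition span (p : W E) : set V := [set x | exists y, scl p x y].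

Lemma cl_refl (p : W E) : cl p (sval p).1 (sval p).2.
Proof.
case: p => [[a b] nab]; exists nab; exact: rt_refl.
Qed.

Lemma cl_step (p : W E) (u v u' v' : V) :
  cl p u v -> ~ E u' v' -> E u u' -> E v v' -> cl p u' v'.
Proof.
move=> [nuv puv] nuv' uu' vv'; exists nuv'.
by apply: rt_trans puv _; apply: rt_step.
Qed.

Lemma scl_sym (p : W E) (u v : V) : scl p u v -> scl p v u.
Proof. by case; [right|left]. Qed.

Lemma scl_nadj (p : W E) (u v : V) : scl p u v -> ~ E u v.
Proof. by move=> [[nuv _]|[nvu _] /symE]. Qed.

Lemma scl_step (p : W E) (u v u' v' : V) :
  scl p u v -> ~ E u' v' -> E u u' -> E v v' -> scl p u' v'.
Proof.
move=> [puv|pvu] nuv uu' vv'; [left|right].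
  exact: cl_step puv _ _ _.
by apply: cl_step pvu _ _ _ => // /symE.
Qed.

Definition far (p : W E) (x u : V) : Prop := ~ E x u /\ ~ scl p x u.

(** If [x] were adjacent to [c'], replacing [c'] by [x] in the pair [b c'] would put [b x] in the
    class; if [x c'] were in the class, replacing [c'] by [c] would put [x c] in it. *)
Lemma far_step (p : W E) (x b c c' : V) :
  scl p b c' -> E c c' -> far p x b -> far p x c -> far p x c'.
Proof.
move=> bc' cc' [nxb nsxb] [nxc nsxc]; split=> [/symE c'x|sxc'].
  apply/nsxb/scl_sym/(scl_step bc') => //.
  by move=> /symE.
by apply/nsxc/(scl_step sxc') => //; apply: symE.
Qed.

(** * Oriented classes, the triangle lemma and modules *)

Section Oriented.
Variable prec : relation V.
Hypothesis precE : interval_order E prec.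

Definition upward (p : W E) : Prop := prec (sval p).1 (sval p).2.

Lemma upward_or_swap (p : W E) : upward p \/ upward (swap p).
Proof. by have [_ total _] := precE; apply: total (svalP p). Qed.

Lemma upward_joined (p q : W E) : joined (Q E) p q -> upward p -> upward q.
Proof.
have [_ total crossing] := precE.
elim=> {p q} [p q [E1 E2] up|//|p q r _ pq _ qr /pq/qr//].
case: (total _ _ (svalP q)) => // down.
by case: (crossing _ _ _ _ up down).
Qed.

Lemma upward_swapF (p : W E) : upward p -> ~ upward (swap p).
Proof.
have [irr _ crossing] := precE.
by move=> up down; case: (crossing _ _ _ _ up down); apply: reflE.
Qed.

Lemma upward_cl (p : W E) (u v : V) : upward p -> cl p u v -> prec u v.
Proof. by move=> up [nuv /upward_joined]; apply. Qed.

Lemma cl_joined (p q : W E) (u v : V) :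
  cl p u v -> cl q u v -> joined (Q E) p q.
Proof.
move=> [nuv puv] [nuv']; rewrite (Prop_irrelevance nuv' nuv).
by move=> /(joined_sym Q_sym); apply: rt_trans.
Qed.

(** Orientation is essential here, since [p] and [swap p] have the same [scl]: two upward classes
    cannot contain one pair in opposite directions. *)
Lemma scl_joined (p q : W E) (u v : V) : upward p -> upward q ->
  scl p u v -> scl q u v -> joined (Q E) p q.
Proof.
have [_ _ crossing] := precE => up uq.
have absurd a b : cl p a b -> cl q b a -> False.
  move=> /(upward_cl up) ab /(upward_cl uq) ba.
  by case: (crossing _ _ _ _ ab ba).
move=> [puv|pvu] [quv|qvu]; [|exfalso|exfalso|].
- exact: cl_joined puv quv.
- exact: absurd puv qvu.
- exact: absurd pvu quv.
- exact: cl_joined pvu qvu.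
Qed.

Lemma far_Q (p q r : W E) (x : V) :
  upward p -> joined (Q E) p q -> Q E q r ->
  far p x (sval q).1 -> far p x (sval q).2 ->
  far p x (sval r).1 /\ far p x (sval r).2.
Proof.
have [_ _ crossing] := precE.
case: q r => [[b c] nbc] [[b' c'] nbc'] up pq qr /= xb xc.
have [/= bb' cc'] := qr.
have bc : cl p b c by exists nbc.
have bc' : cl p b' c' by apply: cl_step bc _ _ _.
(* The coordinates change one at a time, through [(b, c')] or [(b', c)]: the crossing clause forbids
   that both be adjacent. *)
have [Ebc'|nEbc'] := pselect (E b c').
  have [Eb'c|nEb'c] := pselect (E b' c).
    have /symE Ecb' := Eb'c.
    by case: (crossing _ _ _ _ (upward_cl up bc) (upward_cl up bc')).
  have b'c : cl p b' c by apply: cl_step bc _ _ _.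
  have xb' : far p x b' by apply: far_step bb' xc xb; right.
  by split=> //; apply: far_step cc' xb' xc; left.
have bc'' : cl p b c' by apply: cl_step bc _ _ _.
have xc' : far p x c' by apply: far_step cc' xb xc; left.
by split=> //; apply: far_step bb' xc' xb; right.
Qed.

Lemma far_joined (p q r : W E) (x : V) :
  upward p -> joined (Q E) p q -> joined (Q E) q r ->
  far p x (sval q).1 -> far p x (sval q).2 ->
  far p x (sval r).1 /\ far p x (sval r).2.
Proof.
move=> up pq qr; elim: qr pq => {q r} [q r qr pq|//|q r s qr IHqr rs IHrs pq].
  exact: far_Q up pq qr.
by move=> xq1 xq2; have [] := IHqr pq xq1 xq2; apply: IHrs; exact: rt_trans qr.
Qed.

(** Gallai's triangle lemma: being far from both ends is carried along [Q]-paths, which link all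
    pairs of the class. *)
Lemma triangle (p : W E) (x b c b' c' : V) : upward p ->
  scl p b c -> far p x b -> far p x c -> scl p b' c' -> far p x b'.
Proof.
move=> up bc xb xc bc'.
wlog [nbc pbc] : b c bc xb xc / cl p b c.
  move=> wlogbc; case: (bc) => [|cb]; first exact: wlogbc.
  by apply: (wlogbc c b) => //; left.
have far_pair u v (nuv : ~ E u v) :
    joined (Q E) p (pair nuv) -> far p x u /\ far p x v.
  move=> puv; apply: (far_joined (r := pair nuv) up pbc) => //.
  by apply: rt_trans puv; apply: joined_sym pbc; exact: Q_sym.
by case: bc' => -[nuv /far_pair[]].
Qed.

(** Otherwise the triangle lemma, applied to a pair containing [x], would make [x] far from itself,
    against reflexivity. *)
Lemma far_span (p : W E) (x b c : V) : upward p ->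
  scl p b c -> far p x b -> far p x c -> ~ span p x.
Proof.
by move=> up bc xb xc [y xy]; have [] := triangle up bc xb xc xy.
Qed.

Lemma span_module (p : W E) (x b b' : V) : upward p ->
  ~ span p x -> span p b -> ~ E x b -> span p b' -> ~ E x b'.
Proof.
move=> up nx [c bc] nxb [c' bc'].
have nscl y : ~ scl p x y by move=> xy; apply: nx; exists y.
have xb : far p x b by [].
(* Outside the span, far just means non-adjacent. An edge [x c] would let [x] replace [c] in the
   pair [b c] and so enter the span. *)
suff xc : far p x c by have [] := triangle up bc xb xc bc'.
split=> // /symE cx; apply: (nscl b); apply/scl_sym.
by apply: scl_step bc _ _ cx => // /symE.
Qed.

Lemma span_buried (p : W E) (x b : V) : upward p ->
  ~ span p x -> span p b -> ~ E x b -> buried E (span p).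
Proof.
move=> up nx spb nxb; split.
- have pp := cl_refl p.
  exists (sval p).1, (sval p).2; split; last exact: (svalP p).
    by exists (sval p).2; left.
  by exists (sval p).1; right.
- split; last by exists x => -[//|/(_ _ spb)].
  apply/seteqP; split=> // y [Ky [z yz]].
  by apply: (scl_nadj yz); apply: Ky; exists y; apply: scl_sym.
- move=> c r spc Rr /symE.
  have nr : ~ span p r by move=> spr; apply: Rr; left.
  (* Being outside [K], [r] misses some [d] of the span, hence misses all of it by the module
     property. *)
  have [d spd nrd] : exists2 d, span p d & ~ E r d.
    apply: contrapT => nd; apply: Rr; right=> d spd.
    by apply: contrapT => nrd; apply: nd; exists d.
  exact: (span_module up nr spd nrd spc).
Qed.

(** * Uniqueness of the upward class *)

Hypothesis no_buried : ~ exists B : set V, buried E B.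

Lemma dominating (p : W E) (x b : V) :
  upward p -> ~ span p x -> span p b -> E x b.
Proof.
move=> up nx spb; apply: contrapT => nxb.
by apply: no_buried; exists (span p); apply: span_buried nxb.
Qed.

(** If [x] is outside [span q], so is [y], as domination would make them adjacent. Both are then
    adjacent to both ends of [q], an induced 4-cycle that the crossing clause excludes. *)
Lemma span_sub (p q : W E) : upward p -> upward q -> span p `<=` span q.
Proof.
have [_ _ crossing] := precE.
move=> up uq x [y xy]; apply: contrapT => nx.
have ny : ~ span q y by move=> /(dominating uq nx); apply: scl_nadj xy.
have qq := cl_refl q.
have q1 : span q (sval q).1 by exists (sval q).2; left.
have q2 : span q (sval q).2 by exists (sval q).1; right.
have dom z := dominating (x := z) uq.
by case: xy => /(upward_cl up) lt_xy; apply: (crossing _ _ _ _ lt_xy uq);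
  apply: dom.
Qed.

Lemma upward_all_joined (p q : W E) :
  upward p -> upward q -> joined (Q E) p q.
Proof.
move=> up uq; apply: contrapT => npq.
have disj u v : scl p u v -> scl q u v -> False.
  by move=> puv quv; apply: npq; apply: scl_joined puv quv.
(* The contradiction comes from a triangle [b c z] of non-edges with [b c] and [z c] in the class of
   [p] and [b z] in that of [q]: then [c] is far, for [q], from both ends of [b z], yet lies in
   [span q]. *)
pose b := (sval p).1; pose c := (sval p).2.
have bc : scl p b c by left; apply: cl_refl.
have [z bz] : span q b by apply: (span_sub up uq); exists c.
have ncz : ~ E z c.
  move=> zc; apply: (disj b c) => //.
  by apply: scl_step bz _ _ zc => //; apply: scl_nadj bc.
have zb : far p z b.
  split; first exact: (scl_nadj (scl_sym bz)).
  by move=> /scl_sym/disj; apply.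
have zc : scl p z c.
  apply: contrapT => nzc; apply: (far_span up bc zb (conj ncz nzc)).
  by apply: (span_sub uq up); exists b; apply: scl_sym.
have cb : far q c b.
  split; first exact: (scl_nadj (scl_sym bc)).
  by move=> /scl_sym; apply: disj.
have cz : far q c z by split=> [/symE//|/scl_sym]; apply: disj.
apply: (far_span uq bz cb cz).
by apply: (span_sub up uq); exists b; apply: scl_sym.
Qed.

End Oriented.
End Classes.

Theorem theorem3p12 (V : Type) (E : relation V)
  (interval_E : interval_graph E)
  (connected_E : connected_graph E)
  (noncomplete_E : exists a b : V, ~ E a b)
  (no_buried_E : ~ exists B : set V, buried E B) :
  (components (Q E) #= `I_2)%card.
Proof.
have [reflE symE _] := interval_E.
have [prec precE] := interval_graph_order interval_E.
have symQ := Q_sym symE.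
have [p up] : exists p : W E, upward prec p.
  have [a [b nab]] := noncomplete_E.
  by case: (upward_or_swap symE precE (pair nab)) => ?; eexists; eassumption.
have -> : components (Q E) =
    [set component (Q E) p; component (Q E) (swap symE p)].
  apply/seteqP; split=> [_ [q _ <-]|_ [->|->]]; last 2 first.
  - by exists p.
  - by exists (swap symE p).
  (* A downward [q] is handled by joining [swap q] to [p] and swapping back. *)
  case: (upward_or_swap symE precE q) => uq; [left|right];
    apply/(component_eq _ _ symQ).
    exact: (upward_all_joined reflE symE precE).
  rewrite -[q](swapK symE); apply: joined_swap.
  exact: (upward_all_joined reflE symE precE).
apply: card_set2 => /(component_eq _ _ symQ) /(upward_joined precE) /(_ up).
exact: (upward_swapF reflE precE up).
Qed.
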